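(* If $\mathcal P=(\Pi(\Delta^1),\Pi(\Delta^2))$ is a good pair of generalized nef partitions, then $\mathcal P^*:=(\Pi(\nabla^2),\Pi(\nabla^1))$ is a good pair of generalized nef partitions, where $\Pi(\nabla^k)$ denotes the dual of the generalized nef partition $\Pi(\Delta^k)$ for $k=1,2$.
   Context: Let $N\cong\mathbb Z^n$ be a lattice, $M=\mathrm{Hom}(N,\mathbb Z)$, with rational extensions $N_{\mathbb Q},M_{\mathbb Q}$ and pairing $\langle\cdot,\cdot\rangle$. For a polytope $\Delta\subset M_{\mathbb Q}$ containing the origin in its interior, its polar is $\Delta^\circ=\{n\in N_{\mathbb Q}:\langle m,n\rangle\ge -1\ \forall m\in\Delta\}$. A (full-dimensional) lattice polytope is canonical if the origin is its unique interior lattice point. Given a partition $\mathrm{Vert}(\Delta^\circ)=I_1\sqcup\dots\sqcup I_s$ into non-empty sets, put $\Delta_i=\{m:\langle m,n_\rho\rangle\ge-\mathbf 1_i(n_\rho)\ \forall n_\rho\in\mathrm{Vert}(\Delta^\circ)\}$, where $\mathbf 1_i(n_\rho)=1$ if $n_\rho\in I_i$ and $0$ otherwise. The set $\Pi(\Delta)=\{\Delta_1,\dots,\Delta_s\}$ is a generalized nef partition of $\Delta$ if $\Delta=\Delta_1+\dots+\Delta_s$ (Minkowski sum). Its dual is $\Pi(\nabla)=\{\nabla_1,\dots,\nabla_s\}$, where $\nabla_j=\{n:\langle m,n\rangle\ge-\delta_{i,j}\ \forall m\in\Delta_i,\ i=1,\dots,s\}$ and $\nabla=\nabla_1+\dots+\nabla_s$.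 The same notions apply with the roles of $M$ and $N$ exchanged. A good pair of generalized nef partitions is a pair $(\Pi(\Delta^1),\Pi(\Delta^2))$ of generalized nef partitions $\Pi(\Delta^k)=\{\Delta^k_1,\dots,\Delta^k_s\}$, $k=1,2$, such that each $\Delta^1_i$ is a lattice polytope contained in $\Delta^2_i$, and $(\Delta^1,\Delta^2)$ is a good pair of polytopes, i.e. $\Delta^1\subseteq\Delta^2$ and both $\Delta^1$ and $(\Delta^2)^\circ$ are canonical. *)

(* Defs.v *)
From mathcomp Require Import all_boot all_order all_algebra.
From mathcomp Require Import all_classical topology normedtype.

Set Implicit Arguments.
Unset Strict Implicit.
Unset Printing Implicit Defensive.

Import Order.TTheory GRing.Theory Num.Theory.
Import numFieldNormedType.Exports.

Local Open Scope classical_set_scope.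
Local Open Scope ring_scope.

(* A basis of the lattice N and the dual basis of M = Hom(N, Z) identify both
   N_Q and M_Q with 'rV[rat]_n, both lattices with the integral row vectors,
   and the pairing with the dot product.  As the latter is symmetric, each
   definition below serves for subsets of M_Q as well as of N_Q. *)
Definition pairing (n : nat) (x y : 'rV[rat]_n) : rat :=
  \sum_(i < n) x 0 i * y 0 i.

Definition lattice_point (n : nat) (x : 'rV[rat]_n) : Prop :=
  x \is a mxOver Num.int.

Definition convex_hull (n k : nat) (v : 'I_k -> 'rV[rat]_n) : set 'rV[rat]_n :=
  [set x | exists a : 'I_k -> rat,
    [/\ forall i, 0 <= a i, \sum_(i < k) a i = 1 & x = \sum_(i < k) a i *: v i]].

Definition polytope (n : nat) (P : set 'rV[rat]_n) : Prop :=
  exists k (v : 'I_k -> 'rV[rat]_n), P = convex_hull v.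

Definition lattice_polytope (n : nat) (P : set 'rV[rat]_n) : Prop :=
  exists k (v : 'I_k -> 'rV[rat]_n),
    (forall i, lattice_point (v i)) /\ P = convex_hull v.

(* MathComp-Analysis puts the usual topology on rat^o, not on rat itself. *)
Definition interior_of (n : nat) (P : set 'rV[rat]_n) : set 'rV[rat]_n :=
  interior (P : set 'rV[rat^o]_n).

Definition vertices (n : nat) (P : set 'rV[rat]_n) : set 'rV[rat]_n :=
  [set v | P v /\ forall x y (t : rat), P x -> P y -> 0 < t < 1 ->
    v = t *: x + (1 - t) *: y -> x = y].

Definition polar (n : nat) (P : set 'rV[rat]_n) : set 'rV[rat]_n :=
  [set y | forall x, P x -> -1 <= pairing x y].

(* Full-dimensionality is implied: the origin is an interior point. *)
Definition canonical (n : nat) (P : set 'rV[rat]_n) : Prop :=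
  lattice_polytope P /\
  forall x, lattice_point x -> (interior_of P x <-> x = 0).

Definition minkowski_sum (n s : nat) (P : 'I_s -> set 'rV[rat]_n) :
    set 'rV[rat]_n :=
  [set x | exists2 f : 'I_s -> 'rV[rat]_n,
    forall i, P i (f i) & x = \sum_(i < s) f i].

(* The member of the collection attached to the block I of a partition of the
   vertices of the polar of D. *)
Definition block_part (n : nat) (D I : set 'rV[rat]_n) : set 'rV[rat]_n :=
  [set m | forall r, vertices (polar D) r -> - (r \in I)%:R <= pairing m r].

Definition gen_nef_partition (n s : nat) (D : set 'rV[rat]_n)
    (P : 'I_s -> set 'rV[rat]_n) : Prop :=
  [/\ polytope D,
      interior_of D 0,
      exists2 I : 'I_s -> set 'rV[rat]_n,
        partition setT I (vertices (polar D)) &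
        forall i, P i = block_part D (I i)
    & D = minkowski_sum P].

Definition dual_parts (n s : nat) (P : 'I_s -> set 'rV[rat]_n) :
    'I_s -> set 'rV[rat]_n :=
  fun j => [set y | forall i x, P i x -> - (i == j)%:R <= pairing x y].

Definition good_pair (n : nat) (D1 D2 : set 'rV[rat]_n) : Prop :=
  [/\ D1 `<=` D2, canonical D1 & canonical (polar D2)].

Definition good_nef_pair (n s : nat) (D1 : set 'rV[rat]_n)
    (P1 : 'I_s -> set 'rV[rat]_n) (D2 : set 'rV[rat]_n)
    (P2 : 'I_s -> set 'rV[rat]_n) : Prop :=
  [/\ gen_nef_partition D1 P1,
      gen_nef_partition D2 P2,
      forall i, lattice_polytope (P1 i) /\ P1 i `<=` P2 i
    & good_pair D1 D2].

(* Main.v *)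
Require Import Defs.
From mathcomp Require Import all_boot all_order all_algebra.
From mathcomp Require Import all_classical topology normedtype.
From mathcomp Require Import ring lra.

Set Implicit Arguments.
Unset Strict Implicit.
Unset Printing Implicit Defensive.

Import Order.TTheory GRing.Theory Num.Theory.
Import numFieldNormedType.Exports.

Local Open Scope classical_set_scope.
Local Open Scope ring_scope.

(** Let [R] be the finite family of vertices of the polar of [D], each coloured
    by the index of its block.  Everything rests on one consequence of linear
    programming duality, [tight_decomposition].  Choose [m] in [D] minimising
    a given form [y]; then [y] is a nonnegative combination of the [R a] with
    total weight [- <m, y>].  If [m] is the sum of the [m i] in the parts [P i],
    each [<m i, y>] is at least minus the weight of the [R a] of colour [i];
    summing over [i] gives an equality, hence each of these bounds is attained.  So
    the representation of [y] is simultaneously optimal for all the parts.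

    It follows ([dual_parts_hull]) that the [j]-th dual part is the hull of 0
    and of the vertices of colour [j].  It follows also ([polar_dual_vertex])
    that each vertex of the polar of the dual sum [N] lies in some part [P i],
    which colours these vertices.  With this colouring [tight_decomposition]
    applies to [N] and its parts in turn, and shows that [P i] is contained in
    the hull of 0 and the vertices of colour [i].  This makes the dual
    collection a generalized nef partition ([dual_gen_nef]).

    For a good pair write [N1], [N2] for the two dual sums; [N2] is contained
    in [N1] as taking duals reverses inclusions.  The parts of the dual of the
    second partition are hulls of 0 and vertices of the lattice polytope
    [polar D2], so they and [N2] are lattice polytopes.  The vertices of
    [polar N1] lie in the lattice polytopes [P1 i], and are vertices of them, so
    [polar N1] is a lattice polytope; it is contained in [D1], whose only
    interior lattice point is 0.  Finally a lattice point [x] interior to [N2]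
    is interior to [N1], thus pairs with the vertices of [polar N1] to integers
    larger than -1.  So the form [x] is nonnegative on [polar N1], which is a
    neighbourhood of 0, and [x = 0].

    The polyhedral geometry behind this (the separation of a point from a
    convex hull, the fact that a bounded polyhedron is the hull of its finitely
    many vertices) is proved over the rationals by elementary means. *)

(** * The pairing *)

Section Pairing.
Context (n : nat).
Implicit Types x y z : 'rV[rat]_n.

Lemma pairingC x y : pairing x y = pairing y x.
Proof. by apply: eq_bigr => i _; rewrite mulrC. Qed.

Lemma pairingDr x y z : pairing x (y + z) = pairing x y + pairing x z.
Proof. by rewrite -big_split; apply: eq_bigr => i _; rewrite mxE mulrDr. Qed.

Lemma pairingZr a x y : pairing x (a *: y) = a * pairing x y.
Proof. by rewrite mulr_sumr; apply: eq_bigr => i _; rewrite mxE mulrCA. Qed.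

Lemma pairingDl x y z : pairing (x + y) z = pairing x z + pairing y z.
Proof. by rewrite pairingC pairingDr !(pairingC z). Qed.

Lemma pairingZl a x y : pairing (a *: x) y = a * pairing x y.
Proof. by rewrite pairingC pairingZr pairingC. Qed.

Lemma pairing0r x : pairing x 0 = 0.
Proof. by rewrite -(scale0r x) pairingZr mul0r. Qed.

Lemma pairing0l x : pairing 0 x = 0.
Proof. by rewrite pairingC pairing0r. Qed.

Lemma pairingNr x y : pairing x (- y) = - pairing x y.
Proof. by rewrite -scaleN1r pairingZr mulN1r. Qed.

Lemma pairingNl x y : pairing (- x) y = - pairing x y.
Proof. by rewrite pairingC pairingNr pairingC. Qed.

Lemma pairing_sumr (T : finType) (p : pred T) x (F : T -> 'rV_n) :
  pairing x (\sum_(t | p t) F t) = \sum_(t | p t) pairing x (F t).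
Proof. exact: (big_morph _ (pairingDr x) (pairing0r x)). Qed.

Lemma pairing_suml (T : finType) (p : pred T) x (F : T -> 'rV_n) :
  pairing (\sum_(t | p t) F t) x = \sum_(t | p t) pairing (F t) x.
Proof. by rewrite pairingC pairing_sumr; apply: eq_bigr => t _; rewrite pairingC. Qed.

Lemma pairing_self_eq0 x : pairing x x <= 0 -> x = 0.
Proof.
move=> xx0; apply/rowP => i; rewrite mxE; apply/eqP.
have sq0 j : true -> 0 <= x 0 j * x 0 j by move=> _; rewrite -expr2 sqr_ge0.
have /eqP : pairing x x = 0 by apply/le_anti; rewrite xx0 sumr_ge0.
by rewrite psumr_eq0 // => /allP /(_ i); rewrite mem_index_enum mulf_eq0 orbb; apply.
Qed.

Lemma pairing_lattice x y :
  lattice_point x -> lattice_point y -> pairing x y \is a Num.int.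
Proof. by move=> /mxOverP xZ /mxOverP yZ; apply: rpred_sum => i _; apply: rpredM. Qed.

End Pairing.

Lemma pairing_row_mx n1 n2 (x1 y1 : 'rV[rat]_n1) (x2 y2 : 'rV[rat]_n2) :
  pairing (row_mx x1 x2) (row_mx y1 y2) = pairing x1 y1 + pairing x2 y2.
Proof.
by rewrite /pairing big_split_ord /=; congr (_ + _); apply: eq_bigr => i _;
  rewrite ?row_mxEl ?row_mxEr.
Qed.

(** * Convex hulls and separation *)

(** Induction on the number of forms, after Bartl.  If [b] is not already
    nonnegative wherever all forms but the first are, some [x0] witnesses this,
    and the first form is negative there; projecting all forms along the first
    one onto those that vanish at [x0] removes the first form. *)
Lemma farkas n k (a : 'I_k -> 'rV[rat]_n) b :
  (forall x, (forall i, 0 <= pairing (a i) x) -> 0 <= pairing b x) ->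
  exists2 l : 'I_k -> rat, forall i, 0 <= l i & b = \sum_i l i *: a i.
Proof.
elim: k a b => [|k IH] a b ab.
  exists (fun=> 0) => //; rewrite big_ord0; apply: pairing_self_eq0.
  by rewrite -oppr_ge0 -pairingNr; apply: ab; case.
pose a' i := a (lift ord0 i).
have [[x0 a'x0 bx0] | nosep] :=
  pselect (exists2 x0, forall i, 0 <= pairing (a' i) x0 & pairing b x0 < 0).
- pose e := pairing (a ord0) x0.
  have e0 : e < 0.
    rewrite ltNge; apply/negP => e0.
    suff : 0 <= pairing b x0 by rewrite leNgt bx0.
    by apply: ab => i; case: (unliftP ord0 i) => [j ->|->] //; exact: a'x0.
  have enz : e != 0 by rewrite lt_eqF.
  pose proj y := y - (pairing y x0 / e) *: a ord0.
  have [x a'x | l l0 bl] := IH (proj \o a') (proj b).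
    have projE y : pairing (proj y) x =
        pairing y (x - (pairing (a ord0) x / e) *: x0).
      rewrite /proj pairingDl pairingNl pairingZl pairingDr pairingNr pairingZr.
      by field.
    rewrite projE; apply: ab => i; case: (unliftP ord0 i) => [j ->|->].
      by rewrite -projE; exact: a'x.
    by rewrite pairingDr pairingNr pairingZr -/e divfK // subrr.
  pose c := pairing b x0 / e - \sum_i l i * (pairing (a' i) x0 / e).
  exists (fun i => oapp l c (unlift ord0 i)).
    move=> i; case: (unliftP ord0 i) => [j _|_] /=; first exact: l0.
    rewrite /c.
    rewrite subr_ge0; apply: (@le_trans _ _ 0).
      apply: sumr_le0 => j _; apply: mulr_ge0_le0 => //.
      by apply: mulr_ge0_le0 => //; rewrite invr_le0 ltW.
    by rewrite ltW // nmulr_rgt0 // invr_lt0.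
  rewrite big_ord_recl unlift_none /=; under eq_bigr do rewrite liftK /=.
  have -> : b = proj b + (pairing b x0 / e) *: a ord0 by rewrite subrK.
  rewrite bl /c scalerBl scaler_suml [RHS]addrC addrCA [RHS]addrC; congr (_ + _).
  rewrite -sumrB; apply: eq_bigr => i _.
  by rewrite /= /proj scalerBr scalerA.
- have [x a'x | l l0 bl] := IH a' b.
    by rewrite leNgt; apply/negP => bx; apply: nosep; exists x.
  exists (fun i => oapp l 0 (unlift ord0 i)).
    by move=> i; case: (unliftP ord0 i) => /=.
  rewrite big_ord_recl unlift_none /= scale0r add0r bl.
  by apply: eq_bigr => i _; rewrite liftK.
Qed.

(** Generators are indexed by any finite type, as unions and Minkowski sums of
    convex hulls are generated by families over sums and powers of index types. *)
Definition hull n (T : finType) (v : T -> 'rV[rat]_n) : set 'rV[rat]_n :=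
  [set x | exists a : T -> rat,
    [/\ forall t, 0 <= a t, \sum_t a t = 1 & x = \sum_t a t *: v t]].

Definition convex n (P : set 'rV[rat]_n) : Prop :=
  forall (T : finType) (w : T -> rat) (x : T -> 'rV[rat]_n),
    (forall t, 0 <= w t) -> \sum_t w t = 1 -> (forall t, P (x t)) ->
    P (\sum_t w t *: x t).

Lemma hull_convex_hull n (T : finType) (v : T -> 'rV[rat]_n) :
  hull v = convex_hull (fun i : 'I_#|T| => v (enum_val i)).
Proof.
have sumE (V : nmodType) (F : T -> V) :
    \sum_t F t = \sum_(i < #|T|) F (enum_val i).
  by apply: reindex; apply: onW_bij; exact: enum_val_bij.
apply/seteqP; split=> x [a [a0 a1 ->]].
  exists (a \o enum_val); split=> [i||]; [exact: a0| |by rewrite sumE].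
  by rewrite -a1 sumE.
exists (a \o enum_rank); split=> [t||] /=; [exact: a0|rewrite sumE|rewrite sumE].
  by under eq_bigr do rewrite /= enum_valK.
by apply: eq_bigr => i _; rewrite enum_valK.
Qed.

Lemma hull_polytope n (T : finType) (v : T -> 'rV[rat]_n) : polytope (hull v).
Proof. by rewrite hull_convex_hull; exists #|T|, (fun i => v (enum_val i)). Qed.

Lemma hull_lattice_polytope n (T : finType) (v : T -> 'rV[rat]_n) :
  (forall t, lattice_point (v t)) -> lattice_polytope (hull v).
Proof.
move=> vZ; rewrite hull_convex_hull; exists #|T|, (fun i => v (enum_val i)).
by split=> // i; exact: vZ.
Qed.

Lemma hull_gen n (T : finType) (v : T -> 'rV[rat]_n) t : hull v (v t).
Proof.
exists (fun u => (u == t)%:R); split=> [u||]; first exact: ler0n.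
  by rewrite (bigD1 t) //= eqxx big1 ?addr0 // => u /negPf ->.
rewrite (bigD1 t) //= eqxx scale1r big1 ?addr0 // => u /negPf ->.
by rewrite scale0r.
Qed.

Lemma hull_convex n (T : finType) (v : T -> 'rV[rat]_n) : convex (hull v).
Proof.
move=> I w x w0 w1 /choice[a aP].
have [a0 a1 ax] := all_and3 aP.
exists (fun t => \sum_i w i * a i t); split=> [t||].
- by apply: sumr_ge0 => i _; apply: mulr_ge0.
- rewrite exchange_big -[RHS]w1; apply: eq_bigr => i _.
  by rewrite -mulr_sumr a1 mulr1.
- under [RHS]eq_bigr do rewrite scaler_suml.
  rewrite exchange_big; apply: eq_bigr => i _.
  by rewrite ax scaler_sumr; apply: eq_bigr => t _; rewrite scalerA.
Qed.

Lemma convex_segment n (P : set 'rV[rat]_n) x y t :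
  convex P -> P x -> P y -> 0 <= t -> t <= 1 -> P (t *: x + (1 - t) *: y).
Proof.
move=> cP Px Py t0 t1.
have := cP bool (fun b => if b then t else 1 - t) (fun b => if b then x else y).
rewrite !big_bool /=; apply; [case=> //; lra|ring|by case].
Qed.

Lemma hull_sub n (T : finType) (v : T -> 'rV[rat]_n) (P : set 'rV[rat]_n) :
  convex P -> (forall t, P (v t)) -> hull v `<=` P.
Proof. by move=> cP Pv x [a [a0 a1 ->]]; exact: cP. Qed.

Lemma halfspace_convex n (y : 'rV[rat]_n) b :
  convex [set x | b <= pairing x y].
Proof.
move=> T w x w0 w1 xb /=; rewrite pairing_suml -[b]mul1r -w1 mulr_suml.
by apply: ler_sum => t _; rewrite pairingZl ler_wpM2l //; exact: xb.
Qed.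

Lemma hull_subcombination n (T : finType) (v : T -> 'rV[rat]_n) (l : T -> rat) :
  (forall t, 0 <= l t) -> \sum_t l t <= 1 ->
  hull (oapp v 0) (\sum_t l t *: v t).
Proof.
move=> l0 l1; have sumE (V : nmodType) (F : option T -> V) :
    \sum_o F o = F None + \sum_t F (Some t).
  rewrite (bigD1 None) //=; congr (_ + _).
  rewrite (reindex_omap Some id) => [|[]//].
  by apply: eq_bigl => t; rewrite eqxx.
exists (fun o => oapp l (1 - \sum_t l t) o); split=> [[t|] /=||].
- exact: l0.
- by rewrite subr_ge0.
- by rewrite sumE /= subrK.
- by rewrite sumE /= scaler0 add0r.
Qed.

(** Lifting the generators to height 1 turns the hull into a section of the
    cone over it, so that Farkas' lemma applies; the last coordinate of the
    separating form is the offset. *)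
Lemma hull_separation n (T : finType) (v : T -> 'rV[rat]_n) x :
  ~ hull v x ->
  exists y b, pairing x y < b /\ forall z, hull v z -> b <= pairing z y.
Proof.
rewrite hull_convex_hull; set u := fun i : 'I__ => _ => xv.
pose lft (z : 'rV[rat]_n) := row_mx z (const_mx 1 : 'rV[rat]_1).
have pairE z y b : pairing (lft z) (row_mx y (const_mx b : 'rV_1)) = pairing z y + b.
  by rewrite pairing_row_mx [X in _ + X]big_ord1 !mxE mul1r.
have rowE (y : 'rV[rat]_(n + 1)) : y = row_mx (lsubmx y) (const_mx (rsubmx y 0 0)).
  rewrite -[LHS]hsubmxK; congr row_mx.
  by apply/rowP => i; rewrite !mxE !ord1.
have [H|] := pselect (forall y, (forall i, 0 <= pairing (lft (u i)) y) ->
   0 <= pairing (lft x) y).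
  have [l l0 xl] := farkas H; exfalso; apply: xv; exists l; split=> //.
    have := congr1 (fun z : 'rV_(n + 1) => z 0 (rshift n 0)) xl.
    rewrite /= row_mxEr mxE summxE => /esym <-.
    by apply: eq_bigr => i _; rewrite mxE row_mxEr mxE mulr1.
  have := congr1 lsubmx xl; rewrite row_mxKl linear_sum /= => ->.
  by apply: eq_bigr => i _; rewrite linearZ /= row_mxKl.
move=> /existsNP[y /not_implyP[uy /negP]]; rewrite -ltNge => xy.
move: uy xy; rewrite [y]rowE; set b := rsubmx y 0 0 => uy.
rewrite pairE => xy.
exists (lsubmx y), (- b); split; first by lra.
apply: (hull_sub (@halfspace_convex _ (lsubmx y) (- b))).
by move=> i /=; have := uy i; rewrite pairE; lra.
Qed.

(** * Vertices of polyhedra *)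

(** A vertex is not an interior point of any segment of [P], and [x] is the
    convex combination of [x + e1 *: d] and [x - e2 *: d] with weights
    proportional to [e2] and [e1]. *)
Lemma vertex_no_line n (P : set 'rV[rat]_n) x d e1 e2 :
  vertices P x -> 0 < e1 -> 0 < e2 -> P (x + e1 *: d) -> P (x - e2 *: d) ->
  d = 0.
Proof.
move=> [_ Px] e10 e20 P1 P2; have e0 : 0 < e1 + e2 by rewrite addr_gt0.
have h : x + e1 *: d = x - e2 *: d.
  apply: (Px _ _ (e2 / (e1 + e2))) => //.
    by rewrite divr_gt0 //= ltr_pdivrMr // mul1r ltrDr.
  rewrite !scalerDr addrACA -scalerDl subrKC scale1r scalerN !scalerA -scalerBl.
  rewrite [X in X *: d](_ : _ = 0) ?scale0r ?addr0 //.
  by field; rewrite gt_eqF.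
have : (e1 + e2) *: d = 0 by rewrite scalerDl -[e1 *: d](addKr x) h addKr addNr.
by move/eqP; rewrite scaler_eq0 gt_eqF //= => /eqP.
Qed.

(** Half of the weight of a point [x t] of positive weight is split off, so that
    the definition of a vertex applies even if [w t = 1]: the two complementary
    weights [h] and [1 - h] always lie strictly between 0 and 1. *)
Lemma vertex_combination n (P : set 'rV[rat]_n) (T : finType) (w : T -> rat) x :
  convex P -> (forall t, 0 <= w t) -> \sum_t w t = 1 -> (forall t, P (x t)) ->
  vertices P (\sum_t w t *: x t) -> exists t, \sum_t w t *: x t = x t.
Proof.
move=> cP w0 w1 Px [_ vP].
have [t wt0] : exists t, 0 < w t.
  apply: contrapT => /forallNP wt0; have : (0 : rat) < 1 by [].
  rewrite -w1 big1 ?ltxx // => t _; apply/le_anti; rewrite w0 andbT leNgt.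
  exact/negP.
have wt1 : w t <= 1 by rewrite -w1 (bigD1 t) //= lerDl sumr_ge0.
pose h := w t / 2; have h0 : 0 < h by rewrite divr_gt0.
have h1 : h < 1 by rewrite ltr_pdivrMr // mul1r (le_lt_trans wt1) // ltr1n.
pose w' u := (w u - (if u == t then h else 0)) / (1 - h).
have sumD (V : zmodType) (F G : T -> V) :
    \sum_u (F u - (if u == t then G u else 0)) = \sum_u F u - G t.
  by rewrite sumrB; congr (_ - _); rewrite -big_mkcond big_pred1_eq.
have nh : 1 - h != 0 by lra.
pose z := \sum_u w' u *: x u.
have Pz : P z.
  apply: cP => // [u|].
    rewrite divr_ge0 ?subr_ge0 ?(ltW h1) //.
    by case: eqP => // ->; rewrite /h; have := w0 t; lra.
  by rewrite -mulr_suml (sumD _ _ (fun=> h)) w1 divff.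
have wz : \sum_u w u *: x u = h *: x t + (1 - h) *: z.
  rewrite /z scaler_sumr; under [X in _ + X]eq_bigr => u _.
    rewrite scalerA mulrC divfK // scalerBl.
    rewrite [X in _ - X](_ : _ = if u == t then h *: x u else 0); last first.
      by case: ifP; rewrite ?scale0r.
    over.
  by rewrite (sumD _ _ (fun u => h *: x u)) addrC subrK.
exists t; rewrite wz -(vP _ _ h (Px t) Pz _ wz); last by rewrite h0.
by rewrite -scalerDl subrKC scale1r.
Qed.

Lemma vertex_hull n (T : finType) (v : T -> 'rV[rat]_n) x :
  vertices (hull v) x -> exists t, x = v t.
Proof.
move=> vx; have [a [a0 a1 xE]] := vx.1; rewrite xE in vx *.
by apply: (vertex_combination (@hull_convex _ _ v)) => // t; exact: hull_gen.
Qed.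

Definition polyhedron n k (a : 'I_k -> 'rV[rat]_n) (b : 'I_k -> rat) :
    set 'rV[rat]_n :=
  [set x | forall i, - b i <= pairing (a i) x].

Section Polyhedron.
Context (n k : nat) (a : 'I_k -> 'rV[rat]_n) (b : 'I_k -> rat).
Implicit Types x y d : 'rV[rat]_n.

Definition tight x : {set 'I_k} := [set i | pairing (a i) x == - b i].

Lemma polyhedron_convex : convex (polyhedron a b).
Proof.
move=> T w x w0 w1 xP i; rewrite pairingC.
by apply: halfspace_convex => // t /=; rewrite pairingC; exact: xP.
Qed.

(** The slack constraints tolerate any small displacement. *)
Lemma polyhedron_move x d :
  polyhedron a b x -> (forall i, i \in tight x -> 0 <= pairing (a i) d) ->
  exists2 e, 0 < e & polyhedron a b (x + e *: d).
Proof.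
move=> Px xd; pose s i := pairing (a i) x + b i.
have s0 i : 0 <= s i by have := Px i; rewrite /s; lra.
pose N := 1 + \sum_i `|pairing (a i) d| / s i.
have N0 : 0 < N by rewrite ltr_pwDl // sumr_ge0 // => i _; rewrite divr_ge0.
exists N^-1 => [|i]; rewrite ?invr_gt0 // pairingDr pairingZr.
have [ti|nti] := boolP (i \in tight x).
  by rewrite (le_trans (Px i)) // lerDl mulr_ge0 ?xd // invr_ge0 ltW.
have si0 : 0 < s i.
  by rewrite lt0r s0 andbT /s addr_eq0; move: nti; rewrite inE.
suff : - s i <= N^-1 * pairing (a i) d by rewrite /s; lra.
rewrite mulrC ler_pdivlMr // mulNr lerNl; apply: le_trans (ler_norm _) _.
rewrite normrN -ler_pdivrMl // mulrC /N (bigD1 i) //= addrCA lerDl.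
by rewrite addr_ge0 // sumr_ge0 // => j _; rewrite divr_ge0.
Qed.

(** If two vertices have the same tight constraints, these constraints are
    constant on the line through them, which can therefore be prolonged inside
    the polyhedron.  Hence a polyhedron has finitely many vertices. *)
Lemma tight_vertex_inj x y :
  vertices (polyhedron a b) x -> vertices (polyhedron a b) y ->
  tight x = tight y -> x = y.
Proof.
move=> vx vy txy; apply/eqP; rewrite -subr_eq0; apply/eqP.
have d0 i : i \in tight x -> pairing (a i) (x - y) = 0.
  move=> tx; have := tx; rewrite txy; move: tx.
  by rewrite !inE pairingDr pairingNr => /eqP -> /eqP ->; rewrite subrr.
have [|e1 e10 P1] := @polyhedron_move x (x - y) vx.1.
  by move=> i /d0 ->.
have [|e2 e20 P2] := @polyhedron_move x (- (x - y)) vx.1.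
  by move=> i /d0; rewrite pairingNr => ->; rewrite oppr0.
by apply: (vertex_no_line vx e10 e20 P1); rewrite -scalerN.
Qed.

Lemma finite_vertices : exists p (R : 'I_p -> 'rV[rat]_n),
  forall x, vertices (polyhedron a b) x <-> exists i, x = R i.
Proof.
have /finite_seqP[r rE] : finite_set (vertices (polyhedron a b)).
  have /finite_image : finite_set (tight @` vertices (polyhedron a b)).
    exact: finite_finset.
  pose untight T := get [set x | vertices (polyhedron a b) x /\ tight x = T].
  move=> /(_ _ untight); apply: sub_finite_set => x vx.
  exists (tight x); first by exists x.
  have [] : [set y | vertices (polyhedron a b) y /\ tight y = tight x]
      (untight (tight x)).
    by apply: (@getI _ _ x).
  by move=> ? ?; exact: tight_vertex_inj.
exists (size r), (tnth (in_tuple r)) => x; rewrite rE /=; split.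
  by move=> xr; have /tnthP[i ->] : x \in in_tuple r by []; exists i.
by case=> i ->; exact: mem_tnth.
Qed.

Hypothesis bounded : forall d, (forall i, 0 <= pairing (a i) d) -> d = 0.

(** Walk along [d], which preserves the tight constraints, until a new
    constraint becomes tight: among the constraints that decrease along [d],
    the one with the least ratio of slack to speed. *)
Lemma polyhedron_push x d :
  polyhedron a b x -> d != 0 -> (forall i, i \in tight x -> pairing (a i) d = 0) ->
  exists e, [/\ 0 < e, polyhedron a b (x + e *: d)
    & tight x \proper tight (x + e *: d)].
Proof.
move=> Px dn0 xd.
have [i0 i0d] : exists i, pairing (a i) d < 0.
  apply: contrapT => /forallNP nd; move/eqP: dn0; apply; apply: bounded => i.
  by rewrite leNgt; apply/negP.
(* [F i] is the time at which constraint [i] becomes tight. *)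
pose F i := (pairing (a i) x + b i) / - pairing (a i) d.
have [i id iF] := @arg_minP _ _ _ i0 (fun i => pairing (a i) d < 0) F i0d.
have Fd j : pairing (a j) d < 0 -> F j * pairing (a j) d = - (pairing (a j) x + b j).
  by move=> jd; rewrite /F invrN mulrN mulNr divfK // lt_eqF.
have F0 : 0 < F i.
  rewrite divr_gt0 ?oppr_gt0 // lt_neqAle.
  have [ti|_] := eqVneq; last by have := Px i; lra.
  have /xd d0 : i \in tight x by rewrite inE -subr_eq0 opprK -ti.
  by rewrite d0 ltxx in id.
exists (F i); split=> // [j|].
  rewrite pairingDr pairingZr; have [dj|dj] := leP 0 (pairing (a j) d).
    by rewrite (le_trans (Px j)) // lerDl mulr_ge0 // ltW.
  have : F j * pairing (a j) d <= F i * pairing (a j) d by rewrite ler_wnM2r ?iF // ltW.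
  by rewrite Fd //; lra.
apply/properP; split.
  apply/fintype.subsetP => j tj; move: (tj); rewrite !inE pairingDr pairingZr => /eqP ->.
  by rewrite xd // mulr0 addr0.
exists i; first by rewrite inE pairingDr pairingZr Fd //; apply/eqP; ring.
by apply/negP => /xd d0; rewrite d0 ltxx in id.
Qed.

(** Induction on the number of slack constraints: a point that is not a vertex
    lies strictly between two points with more tight constraints. *)
Theorem minkowski_weyl : exists p (R : 'I_p -> 'rV[rat]_n),
  (forall x, vertices (polyhedron a b) x <-> exists i, x = R i) /\
  polyhedron a b = hull R.
Proof.
have [p [R RP]] := finite_vertices; exists p, R; split=> //.
apply/seteqP; split; last first.
  by apply: (hull_sub polyhedron_convex) => i; have [_ /(_ _)[|//]] := RP (R i); exists i.
move=> x; have [m] := ubnP (k - #|tight x|)%N; elim: m x => // m IH x xm Px.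
have [/RP[i ->]|nv] := pselect (vertices (polyhedron a b) x); first exact: hull_gen.
have [u [w [t [Pu Pw /andP[t0 t1] xE uw]]]] : exists u w t, [/\ polyhedron a b u,
    polyhedron a b w, 0 < t < 1, x = t *: u + (1 - t) *: w & u <> w].
  apply: contrapT => H; apply: nv; split=> // u w t Pu Pw t01 xE.
  by apply: contrapT => uw; apply: H; exists u, w, t.
have d0 i : i \in tight x -> pairing (a i) (u - w) = 0.
  rewrite inE xE !(pairingDr, pairingZr, pairingNr) => /eqP.
  have := Pu i; have := Pw i; nra.
have un0 : u - w != 0 by rewrite subr_eq0; apply/eqP.
have [e1 [e10 P1 T1]] := polyhedron_push Px un0 d0.
have [||e2 [e20 P2 T2]] := @polyhedron_push x (- (u - w)) Px.
- by rewrite oppr_eq0.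
- by move=> i /d0; rewrite pairingNr => ->; rewrite oppr0.
have sm y : tight x \proper tight y -> (k - #|tight y| < m)%N.
  move=> /proper_card xy; move: xm; rewrite ltnS; apply: leq_trans.
  apply: ltn_sub2l => //; apply: leq_trans xy _.
  by rewrite -[X in (_ <= X)%N]card_ord max_card.
have e0 : 0 < e1 + e2 by rewrite addr_gt0.
have t0' : 0 <= e2 / (e1 + e2) by rewrite divr_ge0 // ltW.
have t1' : e2 / (e1 + e2) <= 1 by rewrite ler_pdivrMr // mul1r lerDr ltW.
have := convex_segment (@hull_convex _ _ R)
  (IH _ (sm _ T1) P1) (IH _ (sm _ T2) P2) t0' t1'.
move: (u - w) => d; rewrite scalerN !scalerDr addrACA -scalerDl subrKC scale1r.
rewrite scalerN !scalerA -scalerBl [X in X *: _](_ : _ = 0) ?scale0r ?addr0 //.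
by field; rewrite gt_eqF.
Qed.

End Polyhedron.

(** * Minkowski sums *)

Lemma minkowski_convex n s (P : 'I_s -> set 'rV[rat]_n) :
  (forall i, convex (P i)) -> convex (minkowski_sum P).
Proof.
move=> cP T w x w0 w1 xP.
have /choice[f fP] : forall t, exists g : 'I_s -> 'rV[rat]_n,
    (forall i, P i (g i)) /\ x t = \sum_i g i.
  by move=> t; have [g] := xP t; exists g.
exists (fun i => \sum_t w t *: f t i).
  by move=> i; apply: cP => // t; have [] := fP t.
rewrite exchange_big; apply: eq_bigr => t _.
by have [_ ->] := fP t; rewrite scaler_sumr.
Qed.

Lemma minkowskiS n s (P Q : 'I_s -> set 'rV[rat]_n) :
  (forall i, P i `<=` Q i) -> minkowski_sum P `<=` minkowski_sum Q.
Proof. by move=> PQ x [f fP ->]; exists f => // i; exact/PQ/fP. Qed.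

Lemma minkowski_part n s (P : 'I_s -> set 'rV[rat]_n) i :
  (forall j, P j 0) -> P i `<=` minkowski_sum P.
Proof.
move=> P0 x Px; exists (fun j => if j == i then x else 0).
  by move=> j; case: eqP => // ->.
by rewrite -big_mkcond big_pred1_eq.
Qed.

Lemma hull_argmin n (T : finType) (v : T -> 'rV[rat]_n) x y :
  hull v x -> exists t, forall z, hull v z -> pairing (v t) y <= pairing z y.
Proof.
move=> [a [_ a1 _]]; have [t0] : exists t : T, true.
  apply: contrapT => /forallNP noT; have : (0 : rat) < 1 by [].
  by rewrite -a1 big1 ?ltxx // => t; have := noT t.
move=> _; have [t _ tmin] := @arg_minP _ _ _ t0 predT (fun t => pairing (v t) y) isT.
by exists t; apply: (hull_sub (@halfspace_convex _ y _)) => u; exact: tmin.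
Qed.

Lemma polytope_min n (P : set 'rV[rat]_n) x y :
  polytope P -> P x -> exists2 m, P m & forall z, P z -> pairing m y <= pairing z y.
Proof.
move=> [k [v ->]] vx; have [t tmin] := @hull_argmin _ _ v x y vx.
by exists (v t); first exact: (@hull_gen _ _ v).
Qed.

(** A sum of points that is not in the hull of the sums of generators is
    separated from it by a linear form, and the generators that minimise this
    form on each summand give a contradiction. *)
Lemma minkowski_hull n s (T : finType) (v : 'I_s -> T -> 'rV[rat]_n) :
  minkowski_sum (fun i => hull (v i)) =
  hull (fun f : {ffun 'I_s -> T} => \sum_i v i (f i)).
Proof.
apply/seteqP; split=> [x [g gv ->]|]; last first.
  apply: hull_sub; first by apply: minkowski_convex => i; exact: hull_convex.
  by move=> f; exists (fun i => v i (f i)) => // i; exact: hull_gen.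
apply: contrapT => /hull_separation[y [b [gb bv]]].
have /choice[t tP] := fun i => @hull_argmin _ _ (v i) _ y (gv i).
have := bv _ (hull_gen _ [ffun i => t i]); apply/negP; rewrite -ltNge.
apply: le_lt_trans gb; rewrite !pairing_suml; apply: ler_sum => i _.
by rewrite ffunE; exact: tP.
Qed.

(** * The topological interior, tested along rays and on boxes *)

Lemma interior_ofS n (P Q : set 'rV[rat]_n) :
  P `<=` Q -> interior_of P `<=` interior_of Q.
Proof. exact: (@interiorS 'rV[rat^o]_n). Qed.

(** Together with the box criterion below, all that is ever needed of the
    topology: it reduces interiors to statements about the ordered field. *)
Lemma interior_ray n (P : set 'rV[rat]_n) x d :
  interior_of P x -> exists2 e, 0 < e & P (x + e *: d).
Proof.
move=> /nbhs_ballP[e /= e0 eP]; pose N := 1 + \sum_i `|d 0 i|.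
have N0 : 0 < N by rewrite ltr_pwDl // sumr_ge0.
exists (e / N); first by rewrite divr_gt0.
apply: eP; split=> // i j; rewrite /ball /= mxE mxE opprD addNKr normrN ord1.
rewrite normrM ger0_norm; last by rewrite divr_ge0 // ltW.
rewrite mulrAC ltr_pdivrMr // ltr_pM2l // /N (bigD1 j) //= addrCA.
by rewrite ltrDl ltr_pwDl // sumr_ge0.
Qed.

Lemma interior0_box n (P : set 'rV[rat]_n) e :
  0 < e -> (forall x : 'rV[rat]_n, (forall i, `|x 0 i| < e) -> P x) ->
  interior_of P 0.
Proof.
move=> e0 eP; apply/nbhs_ballP; exists e => //= x x0e; apply: eP => i.
by have [_ /(_ 0 i)] := x0e; rewrite /ball /= mxE sub0r normrN.
Qed.

Lemma interior0_mem n (P : set 'rV[rat]_n) : interior_of P 0 -> P 0.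
Proof. by move=> /(interior_ray 0)[e _]; rewrite scaler0 addr0. Qed.

(** Expresses that the polar of a neighbourhood of 0 is bounded. *)
Lemma interior0_pairing_ge0 n (P : set 'rV[rat]_n) d :
  interior_of P 0 -> (forall x, P x -> 0 <= pairing x d) -> d = 0.
Proof.
move=> /(@interior_ray _ _ _ (- d))[e e0]; rewrite add0r => Pd d0.
apply: pairing_self_eq0; have := d0 _ Pd.
by rewrite pairingZl pairingNl pmulr_rge0 // oppr_ge0.
Qed.

Lemma vertex_interior0 n (P : set 'rV[rat]_n) :
  interior_of P 0 -> vertices P 0 -> forall x : 'rV[rat]_n, x = 0.
Proof.
move=> P0 v0 x; have [e1 e10 P1] := interior_ray x P0.
have [e2 e20 P2] := interior_ray (- x) P0.
by apply: (vertex_no_line v0 e10 e20) => //; rewrite -scalerN.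
Qed.

(** * Polars *)

Lemma polar_convex n (D : set 'rV[rat]_n) : convex (polar D).
Proof.
move=> T w x w0 w1 xD y Dy; rewrite pairingC.
by apply: halfspace_convex => // t /=; rewrite pairingC; exact: xD.
Qed.

Lemma polar_hull n (T : finType) (v : T -> 'rV[rat]_n) y :
  polar (hull v) y <-> forall t, -1 <= pairing (v t) y.
Proof.
split=> [vy t|vy x]; first by apply/vy/hull_gen.
exact: (hull_sub (@halfspace_convex _ y (-1))).
Qed.

Lemma polar_interior0 n (D : set 'rV[rat]_n) : polytope D -> interior_of (polar D) 0.
Proof.
move=> [k [v ->]]; pose N := 1 + \sum_(i < k) \sum_j `|v i 0 j|.
have N0 : 0 < N by rewrite ltr_pwDl // sumr_ge0 // => i _; rewrite sumr_ge0.
apply: (@interior0_box _ _ N^-1) => [|x xN]; first by rewrite invr_gt0.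
apply/(@polar_hull _ _ v) => i; rewrite lerNl; apply: le_trans (ler_norm _) _.
rewrite normrN; apply: le_trans (ler_norm_sum _ _ _) _.
apply: (@le_trans _ _ (\sum_j `|v i 0 j| * N^-1)).
  by apply: ler_sum => j _; rewrite normrM ler_wpM2l // ltW.
rewrite -mulr_suml ler_pdivrMr // mul1r /N [in leRHS](bigD1 i) //= addrCA lerDl.
by rewrite addr_ge0 // sumr_ge0 // => j _; rewrite sumr_ge0.
Qed.

(** The polar of a polytope is the polyhedron cut out by its generators, and
    has no recession direction as 0 is interior to the polytope. *)
Lemma polar_vertices n (D : set 'rV[rat]_n) :
  polytope D -> interior_of D 0 -> exists p (R : 'I_p -> 'rV[rat]_n),
    (forall x, vertices (polar D) x <-> exists i, x = R i) /\ polar D = hull R.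
Proof.
move=> [k [v DE]] D0.
have -> : polar D = polyhedron v (fun=> 1).
  by rewrite DE; apply/seteqP; split=> y /(@polar_hull _ _ v).
apply: minkowski_weyl => d vd; apply: (interior0_pairing_ge0 D0) => x.
by rewrite DE; apply: (hull_sub (@halfspace_convex _ d 0)).
Qed.

(** * Duals of generalized nef partitions *)

Lemma sum_by_colour (V : nmodType) s (T : finType) (c : T -> 'I_s) (F : T -> V) :
  \sum_t F t = \sum_i \sum_(t | c t == i) F t.
Proof. exact: (partition_big c predT). Qed.

(** The form [y] is minimised on [D] at a sum of points [m i], so that [y] is
    [- <m, y>] times a point of the polar of [D].  In
    [<m i, y> >= - \sum_(a | c a == i) l a] both sides have the same sum over
    [i], whence equality for each [i]. *)
Lemma tight_decomposition n s p (D : set 'rV[rat]_n)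
    (P : 'I_s -> set 'rV[rat]_n) (R : 'I_p -> 'rV[rat]_n) (c : 'I_p -> 'I_s) y :
  polytope D -> interior_of D 0 -> D = minkowski_sum P -> polar D = hull R ->
  (forall i m a, P i m -> - (c a == i)%:R <= pairing m (R a)) ->
  exists l m, [/\ forall a, 0 <= l a, y = \sum_a l a *: R a, forall i, P i (m i)
    & forall i, pairing (m i) y = - \sum_(a | c a == i) l a].
Proof.
move=> polD D0 DE polarDE PR.
have [m Dm mmin] := polytope_min y polD (interior0_mem D0).
pose t := - pairing m y.
have t0 : 0 <= t.
  by have := mmin _ (interior0_mem D0); rewrite pairing0l /t oppr_ge0.
have [l [l0 lt yE]] : exists l : 'I_p -> rat,
    [/\ forall a, 0 <= l a, \sum_a l a = t & y = \sum_a l a *: R a].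
  have [t00|tn0] := eqVneq t 0.
    exists (fun=> 0); split=> //; first by rewrite big1.
    rewrite big1 => [|a _]; last by rewrite scale0r.
    apply: (interior0_pairing_ge0 D0) => x /mmin; apply: le_trans.
    by rewrite -oppr_le0 -/t t00.
  have tp : 0 < t by rewrite lt0r tn0.
  have : polar D (t^-1 *: y).
    move=> x /mmin xm; rewrite pairingZr mulrC ler_pdivlMr // mulN1r.
    by rewrite /t opprK.
  rewrite polarDE => -[a [a0 a1 aE]]; exists (fun i => t * a i); split.
  - by move=> i; rewrite mulr_ge0.
  - by rewrite -mulr_sumr a1 mulr1.
  - rewrite -[LHS]scale1r -(divff tn0) -scalerA aE scaler_sumr.
    by apply: eq_bigr => i _; rewrite scalerA.
move: Dm; rewrite {1}DE => -[f Pf mE].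
exists l, f; split=> //.
have lb i : 0 <= pairing (f i) y + \sum_(a | c a == i) l a.
  rewrite yE pairing_sumr [X in _ + X]big_mkcond -big_split sumr_ge0 // => a _.
  have := ler_wpM2l (l0 a) (PR i (f i) a (Pf i)).
  by rewrite pairingZr; case: eqP => _ /=; lra.
have /eqP : \sum_i (pairing (f i) y + \sum_(a | c a == i) l a) = 0.
  by rewrite big_split /= -sum_by_colour lt -pairing_suml -mE subrr.
rewrite psumr_eq0 // => /allP f0 i; apply/eqP; rewrite -addr_eq0.
exact: (f0 i (mem_index_enum i)).
Qed.

Lemma dual_parts_convex n s (P : 'I_s -> set 'rV[rat]_n) j :
  convex (dual_parts P j).
Proof.
move=> T w x w0 w1 xP i m Pm; rewrite pairingC.
by apply: halfspace_convex => // t /=; rewrite pairingC; exact: xP.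
Qed.

Lemma dual_parts0 n s (P : 'I_s -> set 'rV[rat]_n) j : dual_parts P j 0.
Proof. by move=> i x _; rewrite pairing0r oppr_le0. Qed.

Lemma dual_partsS n s (P Q : 'I_s -> set 'rV[rat]_n) j :
  (forall i, P i `<=` Q i) -> dual_parts Q j `<=` dual_parts P j.
Proof. by move=> PQ y Qy i x /PQ; exact: Qy. Qed.

Lemma part_sub_polar_dual n s (P : 'I_s -> set 'rV[rat]_n) i :
  P i `<=` polar (minkowski_sum (dual_parts P)).
Proof.
move=> m Pm _ [f fP ->]; rewrite pairingC pairing_sumr.
apply: (@le_trans _ _ (\sum_j - (i == j)%:R)); last first.
  by apply: ler_sum => j _; exact: fP.
rewrite sumrN (bigD1 i) //= eqxx big1 ?addr0 // => j.
by rewrite eq_sym => /negPf ->.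
Qed.

Definition block_gen n s p (R : 'I_p -> 'rV[rat]_n) (c : 'I_p -> 'I_s) j a :=
  if c a == j then R a else 0.

(** If [y] is in the [j]-th dual part, then [tight_decomposition] bounds the
    weight of each colour: it is at most 1 for [j], and 0 for the others. *)
Lemma dual_parts_hull n s p (D : set 'rV[rat]_n)
    (P : 'I_s -> set 'rV[rat]_n) (R : 'I_p -> 'rV[rat]_n) (c : 'I_p -> 'I_s) j :
  polytope D -> interior_of D 0 -> D = minkowski_sum P -> polar D = hull R ->
  (forall i m a, P i m -> - (c a == i)%:R <= pairing m (R a)) ->
  dual_parts P j = hull (oapp (block_gen R c j) 0).
Proof.
move=> polD D0 DE polarDE PR; apply/seteqP; split=> [y yP|]; last first.
  apply: hull_sub; first exact: dual_parts_convex.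
  case=> [a|] /=; last exact: dual_parts0.
  rewrite /block_gen; case: eqP => [<-|_]; last exact: dual_parts0.
  by move=> i m Pm; rewrite eq_sym; exact: PR.
have [l [m [l0 yE Pm my]]] := tight_decomposition y polD D0 DE polarDE PR.
have lj i : \sum_(a | c a == i) l a <= (i == j)%:R.
  by rewrite -lerN2 -my; exact: yP.
have l1 : \sum_a l a <= 1.
  rewrite (sum_by_colour c); apply: le_trans (ler_sum _ (fun i _ => lj i)) _.
  by rewrite (bigD1 j) //= eqxx big1 ?addr0 // => i /negPf ->.
have lc a : c a != j -> l a = 0.
  move=> caj; have := lj (c a); rewrite (negPf caj) => la.
  apply/le_anti; rewrite l0 andbT (le_trans _ la) // (bigD1 a) //= lerDl.
  by rewrite sumr_ge0.
have -> : y = \sum_a l a *: block_gen R c j a.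
  rewrite {1}yE; apply: eq_bigr => a _; rewrite /block_gen.
  by case: eqP => // /eqP /lc ->; rewrite !scale0r.
exact: hull_subcombination.
Qed.

(** A partition of the vertices of the polar into non-empty blocks is the same
    thing as a surjective colouring of them, which is easier to compute with. *)
Lemma gen_nef_partition_colour n s (D : set 'rV[rat]_n) (P : 'I_s -> set 'rV[rat]_n) :
  gen_nef_partition D P <->
  [/\ polytope D, interior_of D 0, D = minkowski_sum P &
    exists c : 'rV[rat]_n -> 'I_s,
    (forall i, exists2 r, vertices (polar D) r & c r = i) /\
    forall i m, P i m <->
      forall r, vertices (polar D) r -> - (c r == i)%:R <= pairing m r].
Proof.
split=> [[polD D0 [I [Icov Itriv Ine] PE] DE]|[polD D0 DE [c [csurj PE]]]].
- split=> //; have [p [R [RP RE]]] := polar_vertices polD D0.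
  have Ivert i r : I i r -> vertices (polar D) r.
    by rewrite -Icov => ?; exists i.
  have Icol r : vertices (polar D) r -> exists i, I i r.
    by rewrite -Icov => -[i _ ?]; exists i.
  have [i0 _] : exists i : 'I_s, True.
    have : polar D 0 by move=> x _; rewrite pairing0r.
    rewrite RE => /hull_argmin-/(_ 0)[a _].
    by have /Icol[i _] : vertices (polar D) (R a) by apply/RP; exists a.
  have /choice[c cP] : forall r, exists i, vertices (polar D) r -> I i r.
    move=> r; have [/Icol[i ?]|nv] := pselect (vertices (polar D) r).
      by exists i.
    by exists i0.
  have cE i r : vertices (polar D) r -> (r \in I i) = (c r == i).
    move=> vr; apply/idP/eqP => [|<-]; last by rewrite in_setE; exact: cP.
    by rewrite in_setE => Ir; apply: Itriv => //; exists r; split=> //; exact: cP.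
  exists c; split=> [i|i m].
    have [r Ir] := Ine i Logic.I; have vr := Ivert _ _ Ir.
    by exists r => //; apply/eqP; rewrite -cE // in_setE.
  rewrite PE; split=> H r vr; [rewrite -cE //|rewrite cE //]; exact: H.
- split=> //; exists (fun i => [set r | vertices (polar D) r /\ c r = i]).
    split=> [|i j _ _ [r [[_ <-] [_ <-]]] //|i _].
      apply/seteqP; split=> [r [i _ []] //|r vr].
      by exists (c r).
    by have [r vr cr] := csurj i; exists r.
  have cE i r : vertices (polar D) r ->
      (r \in [set r | vertices (polar D) r /\ c r = i]) = (c r == i).
    by move=> vr; apply/idP/eqP => [|cr]; rewrite in_setE // => -[].
  move=> i; apply/seteqP; split=> m.
    by move=> /PE mP r vr; rewrite cE //; exact: mP.
  by move=> mP; apply/PE => r vr; rewrite -cE //; exact: mP.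
Qed.

Lemma polar_coloured_vertices n s (D : set 'rV[rat]_n) (P : 'I_s -> set 'rV[rat]_n)
    (c : 'rV[rat]_n -> 'I_s) :
  polytope D -> interior_of D 0 ->
  (forall i m, P i m <->
     forall r, vertices (polar D) r -> - (c r == i)%:R <= pairing m r) ->
  exists p (R : 'I_p -> 'rV[rat]_n),
    [/\ forall r, vertices (polar D) r <-> exists a, r = R a, polar D = hull R &
    forall i m, P i m <-> forall a, - (c (R a) == i)%:R <= pairing m (R a)].
Proof.
move=> polD D0 PE; have [p [R [RP RE]]] := polar_vertices polD D0.
exists p, R; split=> // i m; rewrite PE; split=> H r.
  by apply: H; apply/RP; exists r.
by move=> /RP[a ->]; exact: H.
Qed.

(** The vertex [m] is in the hull of the union of the parts, hence in one of
    them.  Otherwise some form [y] separates [m] from this hull.  Let [t i] be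
    minus the minimum of [m] on the [i]-th dual part, so that the [t i] add up
    to at most 1, and decompose [y] with the points [z i] of the parts.  As
    [<m, R a> >= - t i] for [R a] of colour [i], the value of [y] at [m] is at
    least its value at the subconvex combination of the [z i] with weights
    [t i], a point of the hull as 0 belongs to all the parts. *)
Lemma polar_dual_vertex n s (D : set 'rV[rat]_n) (P : 'I_s -> set 'rV[rat]_n) m :
  gen_nef_partition D P -> vertices (polar (minkowski_sum (dual_parts P))) m ->
  exists i, P i m.
Proof.
move=> /gen_nef_partition_colour[polD D0 DE [c [_ PE]]] vm.
have [p [R [_ RE PR]]] := polar_coloured_vertices polD D0 PE.
have PRle i z a : P i z -> - (c (R a) == i)%:R <= pairing z (R a).
  by move=> /PR.
have P0 i : P i 0 by apply/PR => a; rewrite pairing0l oppr_le0.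
have /choice[kw kwP] : forall i, exists kw : {k & 'I_k -> 'rV[rat]_n},
    P i = hull (projT2 kw).
  move=> i; pose b a : rat := (c (R a) == i)%:R.
  have PiE : P i = polyhedron R b.
    apply/seteqP; split=> z; first by move=> /PR zR a; rewrite pairingC; exact: zR.
    by move=> zR; apply/PR => a; rewrite pairingC; exact: zR.
  have [d Rd|k [w [_ wE]]] := @minkowski_weyl _ _ R b.
    apply: (interior0_pairing_ge0 (polar_interior0 polD)).
    by rewrite RE; apply: (hull_sub (@halfspace_convex _ d 0)) => a; exact: Rd.
  by exists (existT _ k w); rewrite PiE.
pose W (x : {i : 'I_s & 'I_(projT1 (kw i))}) := projT2 (kw (tag x)) (tagged x).
have WP x : P (tag x) (W x) by rewrite kwP; exact: hull_gen.
have PW i z : P i z -> hull W z.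
  rewrite kwP; apply: hull_sub; first exact: hull_convex.
  by move=> t; exact: (hull_gen W (Tagged (fun i => 'I_(projT1 (kw i))) t)).
(* [W] lists generators of all the parts. *)
have [a [a0 a1 mE]] : hull W m; last first.
  rewrite mE in vm *.
  have [|x ->] := vertex_combination (@polar_convex _ _) a0 a1 _ vm.
    by move=> x; apply: part_sub_polar_dual (WP x).
  by exists (tag x).
apply: contrapT => /hull_separation[y [b [myb bW]]].
have [l [z [l0 yE Pz zy]]] := tight_decomposition y polD D0 DE RE PRle.
have polQ i : polytope (dual_parts P i).
  by rewrite (dual_parts_hull _ polD D0 DE RE PRle); exact: hull_polytope.
have /choice[q qP] : forall i, exists q, dual_parts P i q /\
    forall r, dual_parts P i r -> pairing q m <= pairing r m.
  move=> i; have [q Qq qmin] := polytope_min m (polQ i) (@dual_parts0 _ _ P i).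
  by exists q.
pose t i := - pairing (q i) m.
have t0 i : 0 <= t i.
  by have := (qP i).2 _ (@dual_parts0 _ _ P i); rewrite pairing0l oppr_ge0.
have t1 : \sum_i t i <= 1.
  have : minkowski_sum (dual_parts P) (\sum_i q i).
    by exists q => // i; exact: (qP i).1.
  by move/vm.1; rewrite pairing_suml sumrN lerNl.
have ymin : \sum_i t i * pairing (z i) y <= pairing m y.
  rewrite {2}yE [leRHS]pairing_sumr [leRHS](sum_by_colour (c \o R)).
  apply: ler_sum => i _; rewrite zy mulrN mulr_sumr -sumrN; apply: ler_sum => a /eqP caE.
  rewrite pairingZr mulrC -mulrN ler_wpM2l // /t opprK [leRHS]pairingC.
  apply: (qP i).2 => j x /PRle; rewrite -caE eq_sym.
  exact.
suff : b <= \sum_i t i * pairing (z i) y by lra.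
(* There is at least one part, so that 0 is in the hull and [b <= 0]. *)
have [i _] : exists i : 'I_s, True by exists (c 0).
have b0 : b <= 0 by rewrite -(pairing0l y); apply/bW/(PW i).
apply: (@le_trans _ _ (\sum_i t i * b)).
  by rewrite -mulr_suml; nra.
by apply: ler_sum => j _; rewrite ler_wpM2l //; apply/bW/(PW j).
Qed.

(** The vertices of the polar of the dual sum are coloured by a part containing
    them.  That this colouring defines the dual parts is [dual_parts_hull] for
    the dual sum, as each part [P i] is contained in its bidual.  That each
    colour [i] occurs is seen as follows: otherwise [P i] is reduced to 0, so a
    vertex [r] of [polar D] of colour [i] is a combination of 0 and vertices of
    other colours.  Thus [r = 0], which is interior to [polar D]: the space is
    then trivial and all colours coincide. *)
Lemma dual_gen_nef n s (D : set 'rV[rat]_n) (P : 'I_s -> set 'rV[rat]_n) :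
  gen_nef_partition D P ->
  gen_nef_partition (minkowski_sum (dual_parts P)) (dual_parts P).
Proof.
move=> G; have /gen_nef_partition_colour[polD D0 DE [c [csurj PE]]] := G.
have [p [R [RP RE PR]]] := polar_coloured_vertices polD D0 PE.
have PRle i z a : P i z -> - (c (R a) == i)%:R <= pairing z (R a).
  by move=> /PR.
set N := minkowski_sum _.
have polN : polytope N.
  rewrite /N (_ : dual_parts P = fun j => hull (oapp (block_gen R (c \o R) j) 0)).
    by rewrite minkowski_hull; exact: hull_polytope.
  by apply/funext => j; exact: (dual_parts_hull _ polD D0 DE RE PRle).
have N0 : interior_of N 0.
  apply: (interior_ofS _ (polar_interior0 polD)).
  rewrite RE; apply: hull_sub.
    by apply: minkowski_convex => i; exact: dual_parts_convex.
  move=> a; apply: (@minkowski_part _ _ _ (c (R a))); first exact: dual_parts0.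
  by move=> i x /PRle; rewrite eq_sym; exact.
have [q [V [VP VE]]] := polar_vertices polN N0.
have /choice[c' c'P] : forall v, exists i, vertices (polar N) v -> P i v.
  move=> v; have [/(polar_dual_vertex G)[i ?]|] := pselect (vertices (polar N) v).
    by exists i.
  by exists (c 0).
have Vv a : vertices (polar N) (V a) by apply/VP; exists a.
have QV i y a : dual_parts P i y -> - (c' (V a) == i)%:R <= pairing y (V a).
  by move=> Qy; rewrite pairingC; apply: Qy; exact: c'P.
have PV i : P i `<=` hull (oapp (block_gen V (c' \o V) i) 0).
  rewrite -(dual_parts_hull _ polN N0 erefl VE QV) => x Px j y Qy.
  by rewrite pairingC eq_sym; exact: Qy.
apply/gen_nef_partition_colour; split=> //; exists c'; split=> [i|i y]; last first.
  split=> [Qy v /VP[a ->]|Vy k x /PV]; first exact: QV.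
  apply: (hull_sub (@halfspace_convex _ y _)) => -[a|] /=; last first.
    by rewrite pairing0l oppr_le0.
  rewrite /block_gen /=; have [<-|_] := eqVneq (c' (V a)) k; last first.
    by rewrite pairing0l oppr_le0.
  by rewrite pairingC; exact: Vy.
apply: contrapT => noi.
have c'i v : vertices (polar N) v -> c' v != i.
  by move=> vv; apply/eqP => c'v; apply: noi; exists v.
have Pi0 x : P i x -> x = 0.
  move=> /PV[w [_ _ ->]]; rewrite big1 // => -[a|] _ /=; last by rewrite scaler0.
  by rewrite /block_gen /= (negPf (c'i _ (Vv a))) scaler0.
have [r vr cr] := csurj i.
have [l [m [l0 rE Pm mr]]] := tight_decomposition r polD D0 DE RE PRle.
(* As [P i] is reduced to 0, the vertices of colour [i] have weight 0. *)
have li : \sum_(a | c (R a) == i) l a = 0.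
  by apply/eqP; rewrite -oppr_eq0 -(mr i) (Pi0 _ (Pm i)) pairing0l.
have l1 : \sum_a l a <= 1.
  have : D (\sum_i m i) by rewrite DE; exists m.
  move/vr.1; rewrite pairing_suml (sum_by_colour (c \o R)) lerNl -sumrN.
  by under [X in X <= _]eq_bigr do rewrite mr opprK.
pose u a := if c (R a) == i then 0 else R a.
have rE' : r = \sum_a l a *: u a.
  rewrite {1}rE; apply: eq_bigr => a _; rewrite /u; case: ifP => // ca.
  have /eqP := li; rewrite psumr_eq0 // => /allP /(_ a (mem_index_enum a)).
  by rewrite ca => /eqP ->; rewrite !scale0r.
have [w [w0 w1 wE]] := hull_subcombination u l0 l1.
rewrite -rE' in wE.
have pD0 : polar D 0 by move=> x _; rewrite pairing0r.
have pDR a : polar D (R a) by rewrite RE; exact: hull_gen.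
have r0 : r = 0.
  move: (vr); rewrite wE => vr'.
  have [|o] := vertex_combination (@polar_convex _ _) w0 w1 _ vr'.
    by case=> [a|] //=; rewrite /u; case: ifP.
  rewrite -wE; case: o => [a|] //=; rewrite /u; case: eqP => // caN rRa.
  by rewrite rRa in cr.
have all0 : forall x : 'rV[rat]_n, x = 0.
  by apply: (vertex_interior0 (polar_interior0 polD)); rewrite -r0.
have [a _] : exists a : 'I_q, True.
  have : polar N 0 by move=> x _; rewrite pairing0r.
  by rewrite VE => /hull_argmin-/(_ 0)[a _]; exists a.
have [r' _ cr'] := csurj (c' (V a)).
by have := c'i _ (Vv a); rewrite -cr' (all0 r') -r0 cr eqxx.
Qed.

(** * Lattice points and canonical polytopes *)

Lemma lattice_polytope_vertex n (P : set 'rV[rat]_n) v :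
  lattice_polytope P -> vertices P v -> lattice_point v.
Proof.
move=> [k [w [wZ ->]]] vv; have [t ->] := @vertex_hull _ _ w _ vv.
exact: wZ.
Qed.

Lemma polar_dual_vertex_lattice n s (D : set 'rV[rat]_n)
    (P : 'I_s -> set 'rV[rat]_n) v :
  gen_nef_partition D P -> (forall i, lattice_polytope (P i)) ->
  vertices (polar (minkowski_sum (dual_parts P))) v -> lattice_point v.
Proof.
move=> G PZ vv; have [i Pv] := polar_dual_vertex G vv.
apply: (lattice_polytope_vertex (PZ i)); split=> // x y t Px Py.
by apply: vv.2; [exact: part_sub_polar_dual Px|exact: part_sub_polar_dual Py].
Qed.

Lemma dual_parts_lattice_hull n s (D : set 'rV[rat]_n) (P : 'I_s -> set 'rV[rat]_n) :
  gen_nef_partition D P -> lattice_polytope (polar D) ->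
  exists (T : finType) (u : 'I_s -> T -> 'rV[rat]_n),
    (forall i t, lattice_point (u i t)) /\ forall i, dual_parts P i = hull (u i).
Proof.
move=> /gen_nef_partition_colour[polD D0 DE [c [_ PE]]] DZ.
have [p [R [RP RE PR]]] := polar_coloured_vertices polD D0 PE.
exists (option 'I_p), (fun i => oapp (block_gen R (c \o R) i) 0).
split=> i; last first.
  by apply: (dual_parts_hull _ polD D0 DE RE) => j m a /PR; exact.
have Z0 : lattice_point (0 : 'rV[rat]_n) by apply/mxOverP => j k; rewrite mxE rpred0.
case=> [a|] //=; rewrite /block_gen; case: ifP => // _.
by apply: (lattice_polytope_vertex DZ); apply/RP; exists a.
Qed.

(** As [x] is interior to [D], a multiple of [x] by a factor larger than 1 is in
    [D], so that [x] pairs with each vertex of the polar to an integer larger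
    than -1. *)
Lemma lattice_interior_eq0 n (D : set 'rV[rat]_n) x :
  polytope D -> interior_of D 0 ->
  (forall v, vertices (polar D) v -> lattice_point v) ->
  lattice_point x -> interior_of D x -> x = 0.
Proof.
move=> polD D0 vZ xZ Dx; have [p [R [RP RE]]] := polar_vertices polD D0.
apply: (interior0_pairing_ge0 (polar_interior0 polD)) => z.
rewrite RE; apply: (hull_sub (@halfspace_convex _ x 0)) => a /=.
have [e e0 De] := interior_ray x Dx.
have Ra : vertices (polar D) (R a) by apply/RP; exists a.
have := Ra.1 _ De.
rewrite -[X in X + _]scale1r -scalerDl pairingZl pairingC => Rxe.
have /intrP[k kE] := pairing_lattice (vZ _ Ra) xZ.
rewrite kE ler0z leNgt; apply/negP => k0.
have : 1 <= - k by rewrite -gtz0_ge1 oppr_gt0.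
rewrite -(ler_int rat) intrN mulr1z -kE => Rx; have := mulr_gt0 e0 (lt_le_trans ltr01 Rx).
move: (pairing (R a) x) Rxe Rx => q; clear; lra.
Qed.

Theorem proposition3p2 (n s : nat) (D1 D2 : set 'rV[rat]_n)
    (P1 P2 : 'I_s -> set 'rV[rat]_n) :
  good_nef_pair D1 P1 D2 P2 ->
  good_nef_pair
    (minkowski_sum (dual_parts P2)) (dual_parts P2)
    (minkowski_sum (dual_parts P1)) (dual_parts P1).
Proof.
move=> [G1 G2 P12 [_ [_ int1] [D2Z _]]].
have dG1 := dual_gen_nef G1; have dG2 := dual_gen_nef G2.
have P1Z i : lattice_polytope (P1 i) := (P12 i).1.
have Q21 i : dual_parts P2 i `<=` dual_parts P1 i.
  by apply: dual_partsS => j; have [] := P12 j.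
have N21 := minkowskiS Q21.
have [_ _ _ D1E] := G1; have [polN1 N10 _ _] := dG1; have [_ N20 _ _] := dG2.
have [T [u [uZ QE]]] := dual_parts_lattice_hull G2 D2Z.
have vZ := polar_dual_vertex_lattice G1 P1Z.
split=> //.
  by move=> i; split; [rewrite QE; exact: hull_lattice_polytope|exact: Q21].
split=> //.
- split.
    have -> : dual_parts P2 = fun i => hull (u i) by apply/funext.
    rewrite minkowski_hull; apply: hull_lattice_polytope => f.
    apply/mxOverP => a b; rewrite summxE rpred_sum // => i _.
    by have /mxOverP := uZ i (f i); exact.
  move=> x xZ; split=> [N2x|->] //.
  by apply: (lattice_interior_eq0 polN1 N10 vZ xZ); exact: interior_ofS N2x.
- have [p [R [RP RE]]] := polar_vertices polN1 N10.
  split.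
    by rewrite RE; apply: hull_lattice_polytope => a; apply/vZ/RP; exists a.
  move=> x xZ; split=> [Nx|->]; last exact: polar_interior0.
  apply/(int1 x xZ); apply: interior_ofS Nx; rewrite RE D1E.
  have [polD1 D10 _ [c [_ PE]]] := (gen_nef_partition_colour _ _).1 G1.
  apply: hull_sub => [|a].
    apply: minkowski_convex => i; have [k [v [_ ->]]] := P1Z i.
    exact: (@hull_convex _ _ v).
  have [i Pa] : exists i, P1 i (R a).
    by apply: (polar_dual_vertex G1); apply/RP; exists a.
  apply: (@minkowski_part _ _ _ i) => // j; apply/PE => r _.
  by rewrite pairing0l oppr_le0.
Qed.
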